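(* For any connected (simple) graph $\mathcal{G}=(V,E)$ with total edge length $l(E)$, the time-average AoI under every feasible policy $\psi\in\mathcal{F}$ satisfies $$\overline{\Delta}(\mathcal{G};\psi)\ge \tfrac12\, l(E)^2 .$$ The lower bound can be reached when there exists an Eulerian cycle within $\mathcal{G}$.
   Context: $\mathcal{G}=(V,E)$ is a connected simple graph with finitely many nodes; each edge is regarded as a segment of positive length, and $l(E)$ is the total length of all edges. An Eulerian cycle is a closed walk using each edge exactly once. Policies: a single UAV moves along the edges at unit speed and must patrol all the edges. $\mathcal{F}$ is the set of patrol policies under which all edges are traversed by the UAV without changing direction halfway along an edge and the UAV never halts while traversing; policies in $\mathcal{F}$ may be non-periodic. Age: for a point $x$ on an edge, the temporary age at time $t$ is $\Delta(x,t)=t-U(x,t)$, where $U(x,t)$ is the most recent time that $x$ was visited. Let $Y_u(t)$ be the set of points $x$ on the edges with $\Delta(x,t)>u$, and $l(Y_u(t))$ its Lebesgue (length) measure. It is assumed throughout that the temporary age at time $t$ is finite almost everywhere, i.e. $l(Y_\infty(t))=0$, where $Y_\infty(t)$ is the set of points of infinite age. The time-average Age of Information (AoI) under policy $\psi$ is $$\overline{\Delta}(\mathcal{G};\psi)=\lim_{T\to\infty}\frac1T\int_0^T\int_0^\infty l(Y_u(t))\,du\,dt=\lim_{T\to\infty}\frac1T\int_0^T\int_{x\in\bigcup_{e\in E} e}\Delta(x,t)\,dx\,dt .$$ *)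

(* Defs.v *)
From HB Require Import structures.
From mathcomp Require Import all_boot all_order all_algebra.
From mathcomp Require Import all_classical all_reals all_analysis.

Set Implicit Arguments.
Unset Strict Implicit.
Unset Printing Implicit Defensive.

Import Order.TTheory GRing.Theory Num.Theory numFieldNormedType.Exports.

Local Open Scope classical_set_scope.
Local Open Scope ring_scope.

(* [len x y] is only meaningful when [adj x y]. *)
Record metric_graph (R : realType) := MetricGraph {
  node :> finType;
  adj : rel node;
  len : node -> node -> R;
  adj_sym : symmetric adj;
  adj_irr : irreflexive adj;
  len_sym : forall x y, adj x y -> len x y = len y x;
  len_gt0 : forall x y, adj x y -> 0 < len x y }.

Definition graph_connected (R : realType) (G : metric_graph R) : Prop :=
  forall x y : G, connect (@adj R G) x y.

(* Each undirected edge {x, y} is represented once, by the pair whose first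
   component comes first in the enumeration of the nodes.  A point on the edge
   p is given by its distance s to p.1, with 0 < s < len p.1 p.2: the nodes, a
   null set shared between edges, are left out. *)
Definition edges (R : realType) (G : metric_graph R) : {set G * G} :=
  [set p | adj p.1 p.2 & (enum_rank p.1 < enum_rank p.2)%N]%SET.

Definition total_length (R : realType) (G : metric_graph R) : R :=
  \sum_(p in edges G) len p.1 p.2.

(* Total length of a set of points, given as its trace A p on each edge p. *)
Definition edge_length (R : realType) (G : metric_graph R)
    (A : G * G -> set R) : \bar R :=
  (\sum_(p in edges G) lebesgue_measure (A p))%E.

(* The closed walk c_0, c_1, ..., c_(k-1), c_0 uses each edge exactly once. It
   is required to be non-empty, so that the one-node graph, on which there is
   nothing to patrol, has no Eulerian cycle. *)
Definition eulerian_cycle (R : realType) (G : metric_graph R) (c : seq G) :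
    Prop :=
  [/\ c != [::], cycle (@adj R G) c
    & forall p, p \in edges G ->
        count (fun q => (q == p) || (q == (p.2, p.1))) (zip c (rot 1 c)) = 1%N].

(* The UAV leaves node [walk n] at time [depart n] and heads for
   [walk (n + 1)].  Time runs over the whole real line: every age at times
   t >= 0 is thus determined by the past motion of the UAV, without any
   initial condition at time 0, and at time 0 the UAV may be anywhere. *)
Record policy (R : realType) (G : metric_graph R) := Policy {
  walk : int -> G;
  depart : int -> R }.

(* The class F: the UAV follows edges from end to end (so it never turns back
   inside an edge), at unit speed and without halting, and every edge is
   patrolled. *)
Definition feasible (R : realType) (G : metric_graph R) (psi : policy G) :
    Prop :=
  [/\ forall n, adj (walk psi n) (walk psi (n + 1)),
      forall n, depart psi (n + 1) =
                depart psi n + len (walk psi n) (walk psi (n + 1))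
    & forall p, p \in edges G -> exists n,
        (walk psi n, walk psi (n + 1)) = p \/
        (walk psi (n + 1), walk psi n) = p].

(* The UAV is at the point of edge p at distance s from p.1 at time t. *)
Definition visits (R : realType) (G : metric_graph R) (psi : policy G)
    (p : G * G) (s t : R) : Prop :=
  exists n,
    ((walk psi n, walk psi (n + 1)) = p /\ t = depart psi n + s) \/
    ((walk psi (n + 1), walk psi n) = p /\
     t = depart psi n + (len p.1 p.2 - s)).

(* U(x, t), equal to -oo when x has not been visited by time t. *)
Definition last_visit (R : realType) (G : metric_graph R) (psi : policy G)
    (p : G * G) (s t : R) : \bar R :=
  ereal_sup [set r%:E | r in [set r : R | r <= t /\ visits psi p s r]].

Definition age (R : realType) (G : metric_graph R) (psi : policy G)
    (p : G * G) (s t : R) : \bar R :=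
  (t%:E - last_visit psi p s t)%E.

Definition older (R : realType) (G : metric_graph R) (psi : policy G)
    (u t : R) (p : G * G) : set R :=
  [set s | 0 < s < len p.1 p.2 /\ (u%:E < age psi p s t)%E].

Definition never_visited (R : realType) (G : metric_graph R) (psi : policy G)
    (t : R) (p : G * G) : set R :=
  [set s | 0 < s < len p.1 p.2 /\ age psi p s t = +oo%E].

Definition finite_age (R : realType) (G : metric_graph R) (psi : policy G) :
    Prop :=
  forall t : R, 0 <= t -> edge_length (never_visited psi t) = 0%E.

Definition mean_age (R : realType) (G : metric_graph R) (psi : policy G)
    (T : R) : \bar R :=
  ((T^-1)%:E * \int[lebesgue_measure]_(t in `[0%R, T])
     \int[lebesgue_measure]_(u in `[0%R, +oo[)
       edge_length (older psi u t))%E.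

(* L is the time-average age of information; as psi need not be periodic, the
   limit may fail to exist. *)
Definition is_AoI (R : realType) (G : metric_graph R) (psi : policy G)
    (L : \bar R) : Prop :=
  mean_age psi T @[T --> +oo%R] --> L.

(* Main.v *)
(* By unit speed, the UAV visits at most length b - a during [a, b], so at every
   time t the points of age more than u have length at least l(E) - u;
   integrating over u gives l(E)^2 / 2 for each t.  Conversely, repeating an
   Eulerian cycle visits every point in each time window of length l(E), so a
   point of age more than u was visited during [t - l(E), t - u], and the same
   speed bound shows that the lower bound is attained at every t. *)
Require Import Defs.
From mathcomp Require Import all_boot all_order all_algebra.
From mathcomp Require Import all_classical all_reals all_analysis.
From mathcomp Require Import measurable_realfun lra zify.

Set Implicit Arguments.
Unset Strict Implicit.
Unset Printing Implicit Defensive.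

Import Order.TTheory GRing.Theory Num.Theory numFieldNormedType.Exports.

Local Open Scope classical_set_scope.
Local Open Scope ring_scope.

(** * Integrals and outer measure on the real line *)

Section integrals.
Variable R : realType.
Notation mu := (@lebesgue_measure R).
Local Open Scope ereal_scope.

(* Unlike [ge0_le_integral], this needs no measurability. *)
Lemma ge0_le_integralW (D : set R) (f g : R -> \bar R) :
  (forall x, D x -> 0 <= f x) -> (forall x, D x -> f x <= g x) ->
  \int[mu]_(x in D) f x <= \int[mu]_(x in D) g x.
Proof.
move=> f0 fg; have g0 x : D x -> 0 <= g x.
  by move=> Dx; exact: le_trans (f0 x Dx) (fg x Dx).
rewrite !ge0_integralE//; apply: le_ereal_sup => _ [h hf <-].
by exists h => // x; apply: (le_trans (hf x)); exact: lee_restrict.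
Qed.

(* On non-measurable sets [lebesgue_measure] is still the outer measure. *)
Lemma le_lebesgue_measure (A B : set R) : A `<=` B -> mu A <= mu B.
Proof. exact: (@le_outer_measure _ _ (wlength idfun)^*%mu). Qed.

Lemma lebesgue_measureU2 (A B : set R) : mu (A `|` B) <= mu A + mu B.
Proof. exact: (@outer_measureU2 _ _ (wlength idfun)^*%mu). Qed.

Lemma lebesgue_measure_bigU (F : (set R)^nat) n :
  mu (\big[setU/set0]_(i < n) F i) <= \sum_(i < n) mu (F i).
Proof. exact: (@outer_measure_subadditive _ _ (wlength idfun)^*%mu). Qed.

Lemma lebesgue_measure_sub_itv (A : set R) (a b : R) : (a <= b)%R ->
  (forall x, A x -> (a <= x <= b)%R) -> mu A <= (b - a)%:E.
Proof.
move=> ab sA; have : mu A <= mu `[a, b].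
  by apply: le_lebesgue_measure => x /sA; rewrite /= in_itv.
rewrite lebesgue_measure_itv /= lte_fin; case: ltP => [_|ba].
  by rewrite EFinB.
by move=> /le_trans; apply; rewrite lee_fin subr_ge0.
Qed.

(** The area of a right triangle with both legs [L], the integrand being 0 beyond [L]. It is the
    integral over [u] of the lower bound for the length of the points older than [u]. *)
Lemma integral_affine_part (L : R) : (0 < L)%R ->
  \int[mu]_(u in `[0%R, +oo[) (Num.max (L - u) 0)%:E = (2^-1 * L ^+ 2)%:E.
Proof.
move=> L0.
have -> : `[0%R, +oo[%classic = `[0%R, L]%classic `|` `]L, +oo[%classic.
  apply/seteqP; split => u /=; rewrite !in_itv /= !andbT.
    by move=> u0; rewrite u0/=; case: (leP u L) => ?; [left|right].
  by case=> [/andP[]//|]; move=> /(lt_trans L0)/ltW.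
rewrite ge0_integral_setU//=.
- rewrite [X in _ + X]integral0_eq ?adde0; last first.
    move=> u /=; rewrite in_itv/= andbT => Lu; congr EFin.
    by apply/max_idPr; lra.
  have -> : \int[mu]_(x in `[0%R, L]) (Num.max (L - x) 0)%:E =
      \int[mu]_(x in `[0%R, L]) (L - x)%:E.
    apply: eq_integral => u; rewrite inE /= in_itv/= => /andP[_ uL]; congr EFin.
    by apply/max_idPl; lra.
  pose F (u : R) : R := (L * u - 2^-1 * u ^+ 2)%R.
  have dF (u : R) : is_derive u 1%R F (L - u)%R.
    rewrite /F; apply: is_derive_eq; rewrite /GRing.scale /=; lra.
  rewrite (@continuous_FTC2 _ _ F)//.
  + by rewrite -EFinB /F; congr EFin; lra.
  + apply: continuous_subspaceT => u.
    by apply: continuousB; [exact: cst_continuous|exact: cvg_id].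
  + have cF : continuous F.
      by move=> u; apply/differentiable_continuous/derivable1_diffP; case: (dF u).
    split; [by move=> u _; case: (dF u)| |].
      by apply: cvg_at_right_filter; exact: cF.
    by apply: cvg_at_left_filter; exact: cF.
  + by move=> u _; rewrite derive1E; apply: derive_val.
- apply/measurable_EFinP; apply: measurable_maxr => //.
  exact: measurable_funB.
- by move=> u _; rewrite lee_fin le_max lexx orbT.
- rewrite disj_set2E; apply/eqP; rewrite -subset0 => u [/=]; rewrite !in_itv /= andbT.
  by move=> /andP[_ uL]; rewrite ltNge uL.
Qed.

End integrals.

Lemma int_window (m n : int) (N : nat) : m <= n -> n < m + N%:Z ->
  exists2 i : nat, (i < N)%N & n = m + i%:Z.
Proof. by move=> mn nN; exists `|n - m|%N; lia. Qed.

(** * Length of the points visited in a time window *)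

Section policies.
Variables (R : realType) (G : metric_graph R).
Implicit Types (psi : policy G) (p : G * G) (a b s t u : R) (n : int).
Notation mu := (@lebesgue_measure R).

Lemma edges_adj p : p \in edges G -> adj p.1 p.2.
Proof. by rewrite inE => /andP[]. Qed.

Lemma edges_swap p : p \in edges G -> (p.2, p.1) \notin edges G.
Proof.
by rewrite !inE /= => /andP[_ lt12]; rewrite negb_and -leqNgt (ltnW lt12) orbT.
Qed.

Lemma adj_edges (x y : G) : adj x y -> (x, y) \in edges G \/ (y, x) \in edges G.
Proof.
move=> axy; rewrite !inE /= axy adj_sym axy /=.
case: ltngtP => [|| /val_inj/enum_rank_inj exy]; [by left|by right|].
by move: axy; rewrite exy adj_irr.
Qed.

Lemma total_length_gt0 (x y : G) : adj x y -> 0 < total_length G.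
Proof.
have len_pos p : p \in edges G -> 0 < len p.1 p.2.
  by move=> /edges_adj/len_gt0.
have pos p : p \in edges G -> 0 < total_length G.
  move=> pE; rewrite /total_length (bigD1 p) //= ltr_wpDr ?len_pos //.
  by apply: sumr_ge0 => q /andP[/len_pos/ltW].
by move=> /adj_edges[] /pos.
Qed.

(** The graph is finite, so the durations of legs are bounded away from 0; hence departure times are
    unbounded in both directions. *)
Lemma adj_len_lb : exists2 d : R, 0 < d & forall x y : G, adj x y -> d <= len x y.
Proof.
pose A := [seq q <- enum {: G * G} | adj q.1 q.2].
(* The initial value 1 keeps the minimum positive even if there is no edge. *)
exists (\big[Num.min/1]_(q <- A) len q.1 q.2).
  rewrite big_seq; elim/big_ind : _ => // [x y x0 y0|q].
    by rewrite lt_min x0.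
  by rewrite mem_filter => /andP[/len_gt0].
move=> x y axy; rewrite [leRHS](_ : _ = len (x, y).1 (x, y).2) //.
have : (x, y) \in A by rewrite mem_filter axy mem_enum.
elim: A => // q A IH; rewrite inE big_cons ge_min => /predU1P[->|/IH ->].
  by rewrite lexx.
by rewrite orbT.
Qed.

Lemma le_edge_length (A B : G * G -> set R) :
  (forall p, p \in edges G -> A p `<=` B p) ->
  (edge_length A <= edge_length B)%E.
Proof. by move=> AB; apply: lee_sum => p /AB; exact: le_lebesgue_measure. Qed.

Definition visited psi a b p : set R :=
  [set s | 0 < s < len p.1 p.2 /\ exists r, a <= r <= b /\ visits psi p s r].

Definition visits_leg psi n p s t : Prop :=
  ((walk psi n, walk psi (n + 1)) = p /\ t = depart psi n + s) \/
  ((walk psi (n + 1), walk psi n) = p /\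
     t = depart psi n + (len p.1 p.2 - s)).

Definition visited_leg psi a b n p : set R :=
  [set s | 0 < s < len p.1 p.2 /\
           exists r, a <= r <= b /\ visits_leg psi n p s r].

(** For [a <= b], the projection of [t] onto [[a, b]]; a difference of clamped times is the length
    of the part of a time interval lying in the window. *)
Definition clamp a b t : R := Num.max a (Num.min b t).

Lemma clamp_le a b t u : t <= u -> clamp a b t <= clamp a b u.
Proof.
move=> tu; rewrite /clamp ge_max le_max lexx /= le_max; apply/orP; right.
by rewrite le_min ge_min lexx /= ge_min tu orbT.
Qed.

Lemma clamp_id a b t : a <= t <= b -> clamp a b t = t.
Proof. by move=> /andP[at_ tb]; rewrite /clamp (min_idPr tb) (max_idPr at_). Qed.

Section feasible.
Variable psi : policy G.
Hypothesis Fpsi : feasible psi.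

Let walk_adj n : adj (walk psi n) (walk psi (n + 1)).
Proof. by case: Fpsi. Qed.

Let departS n :
  depart psi (n + 1) = depart psi n + len (walk psi n) (walk psi (n + 1)).
Proof. by case: Fpsi. Qed.

Lemma visits_leg_bounds n p s r : p \in edges G -> 0 < s < len p.1 p.2 ->
  visits_leg psi n p s r -> depart psi n < r < depart psi (n + 1).
Proof.
move=> pE /andP[s0 sl] [] [ep ->]; rewrite departS.
  by move: sl; rewrite -ep /= => sl; apply/andP; split; lra.
move: sl; rewrite -ep /= (@len_sym _ _ (walk psi (n + 1))) 1?adj_sym // => sl.
by apply/andP; split; lra.
Qed.

(** One leg stays on one edge and moves at unit speed, so the positions it visits lie in an interval
    as long as the part of its time span inside [[a, b]]. *)
Lemma edge_length_visited_leg a b n : a <= b ->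
  (edge_length (visited_leg psi a b n) <=
   (clamp a b (depart psi (n + 1)) - clamp a b (depart psi n))%:E)%E.
Proof.
move=> ab; set f := (walk psi n, walk psi (n + 1)).
(* [o] is the orientation under which [edges] lists the edge of leg [n]; all other edges contribute
   nothing. *)
pose o := if f \in edges G then f else (f.2, f.1).
have clampS : clamp a b (depart psi n) <= clamp a b (depart psi (n + 1)).
  by apply: clamp_le; rewrite departS lerDl ltW // len_gt0.
have out p : p \in edges G -> p != o -> visited_leg psi a b n p = set0.
  move=> pE /eqP po; rewrite -subset0 => s [_ [r [_]]] [] [ep _]; apply: po.
    by rewrite /o /f ep pE.
  by rewrite /o ifN -?ep //; move: (edges_swap pE); rewrite -ep.
have oE : o \in edges G.
  rewrite /o; case: ifPn => // fE.
  by case: (adj_edges (walk_adj n)) => // fE'; rewrite fE' in fE.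
rewrite /edge_length (bigD1 o) //= big1 ?adde0; last first.
  by move=> p /andP[pE po]; rewrite out // measure0.
have key s r : 0 < s < len o.1 o.2 -> a <= r <= b -> visits_leg psi n o s r ->
    clamp a b (depart psi n) <= r <= clamp a b (depart psi (n + 1)).
  move=> s0 rab /(visits_leg_bounds oE s0)/andP[lo hi].
  by rewrite -{1 2}(clamp_id rab) !clamp_le // ltW.
case: (boolP (f \in edges G)) => fE.
  have eo : o = f by rewrite /o fE.
  (* Forward leg: a visit at time [r] is at position [r - depart psi n], so the time interval is
     shifted. *)
  rewrite (_ : clamp a b (depart psi (n + 1)) - clamp a b (depart psi n) =
     (clamp a b (depart psi (n + 1)) - depart psi n) -
     (clamp a b (depart psi n) - depart psi n)); last by lra.
  apply: lebesgue_measure_sub_itv; first by rewrite lerD2r.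
  move=> s [s0 [r [rab vr]]]; have := key _ _ s0 rab vr.
  case: vr => [[_ ->]|[ef _]]; first by move=> /andP[? ?]; apply/andP; split; lra.
  by have := edges_swap fE; rewrite [X in X \notin _]ef oE.
have eo : o = (f.2, f.1) by rewrite /o (negbTE fE).
set l := len o.1 o.2.
(* Backward leg: the position is [depart psi n + l - r], so the time interval is reflected. *)
rewrite (_ : clamp a b (depart psi (n + 1)) - clamp a b (depart psi n) =
   (depart psi n + l - clamp a b (depart psi n)) -
   (depart psi n + l - clamp a b (depart psi (n + 1)))); last by lra.
apply: lebesgue_measure_sub_itv; first by rewrite lerD2l lerN2.
move=> s [s0 [r [rab vr]]]; have := key _ _ s0 rab vr.
case: vr => [[ef _]|[_ ->]]; last by rewrite -/l => /andP[? ?]; apply/andP; split; lra.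
by move: fE; rewrite /f ef oE.
Qed.

Lemma depart_ge n (d : R) (i : nat) :
  (forall x y : G, adj x y -> d <= len x y) ->
  depart psi n + d *+ i <= depart psi (n + i%:Z).
Proof.
move=> dlen; elim: i => [|i IH]; first by rewrite mulr0n !addr0.
rewrite -addn1 PoszD mulrnDr mulr1n !addrA departS lerD //; exact: dlen.
Qed.

Lemma le_depart : {homo depart psi : m n / m <= n}.
Proof.
move=> m n mn; have [i ->] : exists i : nat, n = m + i%:Z.
  by exists `|n - m|%N; lia.
have := @depart_ge m 0 i (fun x y axy => ltW (len_gt0 axy)).
by rewrite mul0rn addr0.
Qed.

(* Bounding each leg by the clamped length of its time interval makes the sum
   over the legs telescope. *)
Lemma edge_length_visited a b : a <= b ->
  (edge_length (visited psi a b) <= (b - a)%:E)%E.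
Proof.
move=> ab; have [d d0 dlen] := adj_len_lb.
(* Since every leg lasts at least [d], finitely many legs, from [m] up to but excluding [m + N],
   cover [[a, b]]. *)
have [m ma] : exists m, depart psi m <= a.
  pose i := Num.bound (`|(depart psi 0 - a) / d|).
  exists (- i%:Z); have := @depart_ge (- i%:Z) d i dlen; rewrite addNr.
  have : (depart psi 0 - a) / d < i%:R.
    by rewrite (le_lt_trans (ler_norm _)) // archi_boundP.
  rewrite ltr_pdivrMr // mulr_natl; lra.
have [N Nb] : exists N : nat, b <= depart psi (m + N%:Z).
  pose i := Num.bound (`|(b - depart psi m) / d|).
  exists i; have := @depart_ge m d i dlen.
  have : (b - depart psi m) / d < i%:R.
    by rewrite (le_lt_trans (ler_norm _)) // archi_boundP.
  rewrite ltr_pdivrMr // mulr_natl; lra.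
pose F i p := visited_leg psi a b (m + i%:Z) p.
have cover p : p \in edges G -> visited psi a b p `<=` \big[setU/set0]_(i < N) F i p.
  move=> pE s [s0 [r [rab [n vn]]]].
  have /andP[lo hi] := visits_leg_bounds pE s0 vn.
  have /andP[ar rb] := rab.
  (* A visit to an interior point falls strictly between two departures, so a leg before [m], or
     from [m + N] on, would miss the window. *)
  have mn : m <= n.
    rewrite leNgt; apply/negP => nm.
    have /le_depart : n + 1 <= m by rewrite lezD1.
    by lra.
  have nN : n < m + N%:Z.
    by rewrite ltNge; apply/negP => /le_depart; lra.
  have [i iN nE] := int_window mn nN.
  rewrite -(bigcup_mkord N (fun i => F i p)); exists i => //; rewrite /F -nE.
  by split => //; exists r.
apply: (@le_trans _ _ (\sum_(p in edges G) \sum_(i < N) mu (F i p))%E).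
  apply: lee_sum => p pE; apply: (le_trans (le_lebesgue_measure (cover p pE))).
  exact: (lebesgue_measure_bigU (fun i => F i p)).
rewrite exchange_big /=.
apply: (@le_trans _ _ (\sum_(i < N) (clamp a b (depart psi (m + i.+1%:Z)) -
                                clamp a b (depart psi (m + i%:Z)))%:E)%E).
  apply: lee_sum => i _; rewrite -addn1 PoszD addrA.
  exact: edge_length_visited_leg.
rewrite sumEFin lee_fin -(big_mkord xpredT (fun i =>
  clamp a b (depart psi (m + i.+1%:Z)) - clamp a b (depart psi (m + i%:Z)))).
rewrite telescope_sumr //= addr0 /clamp (min_idPl Nb) (max_idPr ab).
by rewrite lerD2l lerN2 le_max lexx.
Qed.

End feasible.

(** * Lower bound on the age at each time *)

Lemma last_visit_ge psi p s t r : r <= t -> visits psi p s r ->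
  (r%:E <= last_visit psi p s t)%E.
Proof. by move=> rt vr; apply: ereal_sup_ubound; exists r. Qed.

(** The last visit is a supremum that need not be attained; the slack [e] yields an actual visit. *)
Lemma olderN_visited psi p s t u e : 0 < e -> 0 < s < len p.1 p.2 ->
  ~ older psi u t p s -> visited psi (t - u - e) t p s.
Proof.
move=> e0 s0 nold; split => //.
have : (age psi p s t <= u%:E)%E by rewrite leNgt; apply/negP => lt; exact: nold.
rewrite /age => aget.
have : ((t - u - e)%:E < last_visit psi p s t)%E.
  move: aget; case: (last_visit psi p s t) => [v| |] //=.
    rewrite lee_fin lte_fin; lra.
  by move=> _; rewrite ltry.
move=> /ereal_sup_gt[_ [r [rt vr] <-]]; rewrite lte_fin => lt_r.
by exists r; rewrite (ltW lt_r).
Qed.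

(** Each interior point either is older than [u] or was visited during [[t - u - e, t]], a window
    that covers length at most [u + e]; subadditivity gives the bound up to [e], which is
    arbitrary. *)
Lemma edge_length_older_ge psi u t : feasible psi -> 0 <= u ->
  ((total_length G - u)%:E <= edge_length (older psi u t))%E.
Proof.
move=> Fpsi u0; apply/lee_addgt0Pr => e e0.
have : ((total_length G)%:E <=
    edge_length (older psi u t) + edge_length (visited psi (t - u - e) t))%E.
  rewrite /total_length -sumEFin /edge_length -big_split /=.
  apply: lee_sum => p pE;   have /ltW l0 := len_gt0 (edges_adj pE).
  have <- : mu `]0, len p.1 p.2[ = (len p.1 p.2)%:E.
    rewrite lebesgue_measure_itv /= lte_fin len_gt0 ?edges_adj //.
    by rewrite oppr0 adde0.
  apply: (le_trans _ (lebesgue_measureU2 _ _)).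
  apply: le_lebesgue_measure => s; rewrite /= in_itv /= => s0.
  by have [?|/olderN_visited] := pselect (older psi u t p s); [left|right; auto].
move=> /le_trans h.
have : ((total_length G)%:E <= edge_length (older psi u t) + (u + e)%:E)%E.
  apply: h; apply: leeD2l.
  have := @edge_length_visited psi Fpsi (t - u - e) t.
  by rewrite (_ : t - (t - u - e) = u + e); [apply; lra|lra].
by rewrite !EFinD !EFinN addeA leeBlDr // -addeA [(_%:E + _)%E]addeC addeA.
Qed.

Lemma mean_age_ge psi T : feasible psi -> 0 < T ->
  ((2^-1 * total_length G ^+ 2)%:E <= mean_age psi T)%E.
Proof.
move=> Fpsi T0; set c := (2^-1 * total_length G ^+ 2).
(* Some leg traverses an edge, so the graph has positive total length. *)
have L0 : 0 < total_length G.
  by case: Fpsi => /(_ 0) /total_length_gt0.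
have : (\int[mu]_(t in `[0%R, T]) (cst c%:E) t <=
   \int[mu]_(t in `[0%R, T]) \int[mu]_(u in `[0%R, +oo[)
       edge_length (older psi u t))%E.
  apply: ge0_le_integralW => t _.
    by rewrite lee_fin mulr_ge0 ?invr_ge0 ?sqr_ge0.
  rewrite -integral_affine_part //; apply: ge0_le_integralW => u.
    by move=> _; rewrite lee_fin le_max lexx orbT.
  rewrite /= in_itv /= andbT => u0; rewrite EFin_max ge_max.
  rewrite edge_length_older_ge //=.
  by apply: sume_ge0 => p _; exact: measure_ge0.
rewrite integral_cst //= lebesgue_measure_itv /= lte_fin T0 oppr0 adde0.
by rewrite -lee_pdivlMr // muleC.
Qed.

End policies.

(** * Policies that revisit every point within a time at most the total length *)

Section recurrent_policies.
Variables (R : realType) (G : metric_graph R) (psi : policy G) (P : R).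
Hypothesis Fpsi : feasible psi.
Hypothesis P_le : P <= total_length G.
Hypothesis recur : forall p s t, p \in edges G -> 0 < s < len p.1 p.2 ->
  exists r, t - P <= r <= t /\ visits psi p s r.
Notation mu := (@lebesgue_measure R).

Lemma recurrent_age_le p s t : p \in edges G -> 0 < s < len p.1 p.2 ->
  (age psi p s t <= P%:E)%E.
Proof.
move=> pE s0; have [r [/andP[Pr rt] vr]] := recur t pE s0.
have := last_visit_ge rt vr; rewrite /age.
case: (last_visit psi p s t) => [v| |] //=; last by rewrite leNye.
by rewrite !lee_fin => rv; lra.
Qed.

Lemma recurrent_finite_age : finite_age psi.
Proof.
move=> t _; rewrite /edge_length big1 // => p pE.
rewrite (_ : never_visited psi t p = set0) ?measure0 // -subset0 => s [s0 aoo].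
by have := recurrent_age_le t pE s0; rewrite aoo leye_eq.
Qed.

(** The visit during [[t - P, t]] is no later than the last visit, which precedes [t - u] for a
    point older than [u]. *)
Lemma older_sub_visited u t p : p \in edges G ->
  older psi u t p `<=` visited psi (t - P) (t - u) p.
Proof.
move=> pE s [s0 old]; split => //.
have [r [/andP[Pr rt] vr]] := recur t pE s0; exists r; split => //.
rewrite Pr /=; move: old (last_visit_ge rt vr); rewrite /age.
case: (last_visit psi p s t) => [v| |] //=.
by rewrite lte_fin lee_fin => uv rv; lra.
Qed.

(** The general lower bound is met: for [u <= P] the older points were all visited in a window of
    length [P - u], at most [total_length G - u], and for [u > P] there are none. *)
Lemma recurrent_edge_length_older u t : 0 <= u ->
  edge_length (older psi u t) = (Num.max (total_length G - u) 0)%:E.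
Proof.
move=> u0; apply/eqP; rewrite eq_le; apply/andP; split; last first.
  rewrite EFin_max ge_max edge_length_older_ge //=.
  by apply: sume_ge0 => p _; exact: measure_ge0.
have [uP|Pu] := leP u P.
  apply: (le_trans (le_edge_length (fun p => @older_sub_visited u t p))).
  apply: (le_trans (edge_length_visited Fpsi _)); first lra.
  by rewrite lee_fin le_max; apply/orP; left; move: P_le; lra.
rewrite /edge_length big1 ?lee_fin ?le_max ?lexx ?orbT // => p pE.
rewrite (_ : older psi u t p = set0) ?measure0 // -subset0 => s [s0].
by move=> /lt_le_trans/(_ (recurrent_age_le t pE s0)); rewrite lte_fin ltNge ltW.
Qed.

(** The distribution of ages is the same at every time, so the average is already exact for finite
    [T]. *)
Lemma recurrent_mean_age T : 0 < T ->
  mean_age psi T = (2^-1 * total_length G ^+ 2)%:E.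
Proof.
move=> T0; set c := (2^-1 * total_length G ^+ 2).
have L0 : 0 < total_length G by case: Fpsi => /(_ 0) /total_length_gt0.
rewrite /mean_age (_ : (\int[mu]_(t in _) _)%E =
    (\int[mu]_(t in `[0%R, T]) (cst c%:E) t)%E).
  rewrite integral_cst //= lebesgue_measure_itv /= lte_fin T0 oppr0 adde0.
  by rewrite -EFinM; congr EFin; rewrite mulrCA mulVf ?mulr1 // gt_eqF.
apply: eq_integral => t _; rewrite /= -integral_affine_part //.
apply: eq_integral => u; rewrite inE /= in_itv /= andbT => u0.
exact: recurrent_edge_length_older.
Qed.

Lemma recurrent_is_AoI : is_AoI psi (2^-1 * total_length G ^+ 2)%:E.
Proof.
apply: cvg_near_cst; near=> T; apply: recurrent_mean_age.
by near: T; apply: nbhs_pinfty_gt; rewrite num_real.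
Unshelve. all: by end_near. Qed.

End recurrent_policies.

(** * The periodic policy that repeats an Eulerian cycle *)

Section eulerian.
Variables (R : realType) (G : metric_graph R) (x : G) (c : seq G).
Hypothesis Ec : eulerian_cycle c.
(* With [x] as default value, [nth x c k] wraps around to the first node. *)
Hypothesis c0 : nth x c 0 = x.
Notation k := (size c).

Let leg_len i : R := len (nth x c i) (nth x c i.+1).
Let elapsed i : R := \sum_(0 <= j < i) leg_len j.
Let period : R := elapsed k.

(** Euclidean division splits [n] into a lap number and a position in the lap; it also handles
    negative [n], so the motion is periodic on the whole time line. *)
Definition cycle_policy : policy G := Policy
  (fun n => nth x c `|(n %% k)%Z|)
  (fun n => (n %/ k)%Z%:~R * period + elapsed `|(n %% k)%Z|).

Let nth_rot1 i : nth x (rot 1 c) i = nth x c i.+1.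
Proof.
case: c c0 => [|y c'] /= yx; first by rewrite !nth_nil.
by rewrite rot1_cons nth_rcons yx if_same; case: ltnP => // ?; rewrite nth_default.
Qed.

Let nth_cycle_zip i :
  nth (x, x) (zip c (rot 1 c)) i = (nth x c i, nth x c i.+1).
Proof. by rewrite nth_zip ?size_rot // nth_rot1. Qed.

Let size_cycle_zip : size (zip c (rot 1 c)) = k.
Proof. by rewrite size_zip size_rot minnn. Qed.

Let cycle_adj i : (i < k)%N -> adj (nth x c i) (nth x c i.+1).
Proof.
move=> ik; rewrite -nth_rot1; case: Ec ik => _ + _.
case: c => //= y c' /(pathP x) adj_c ik.
have := adj_c i; rewrite size_rcons => /(_ ik).
by rewrite rot1_cons -rcons_cons nth_rcons /= ik.
Qed.

Let k_gt0 : (0 < k)%N.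
Proof. by rewrite lt0n size_eq0; case: Ec. Qed.

Let modk_lt (n : int) : (`|(n %% k)%Z| < k)%N.
Proof. by move: k_gt0; lia. Qed.

Let divmod_succ (n : int) :
  if `|(n %% k)%Z|.+1 == k
  then ((n + 1) %% k)%Z = 0 /\ ((n + 1) %/ k)%Z = (n %/ k)%Z + 1
  else ((n + 1) %% k)%Z = `|(n %% k)%Z|.+1 /\ ((n + 1) %/ k)%Z = (n %/ k)%Z.
Proof.
set r := `|(n %% k)%Z|%N.
have k0 : k%:Z != 0 by rewrite eqz_nat -lt0n.
have nE : n + 1 = (n %/ k)%Z * k + r.+1.
  by rewrite {1}(divz_eq n k) /r -addn1 PoszD gez0_abs ?modz_ge0 // -addrA.
have := modk_lt n; rewrite -/r leq_eqVlt; case: eqP => [rk _|_ /= rk].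
  have -> : n + 1 = ((n %/ k)%Z + 1) * k + 0.
    by rewrite nE rk mulrDl mul1r addr0.
  by rewrite modzMDl mod0z divzMDl // div0z addr0.
by rewrite nE modzMDl modz_small // divzMDl // (@divz_small r.+1) // addr0.
Qed.

Let walkS n : walk cycle_policy (n + 1) = nth x c `|(n %% k)%Z|.+1.
Proof.
rewrite /=; have := divmod_succ n; case: eqP => [rk [-> _]|_ [-> _] //].
by rewrite [RHS]nth_default ?rk.
Qed.

Let cycle_departS n : depart cycle_policy (n + 1) =
  depart cycle_policy n + leg_len `|(n %% k)%Z|.
Proof.
rewrite /= -addrA -big_nat_recr //= -/(elapsed _.+1).
have := divmod_succ n; case: eqP => [rk|_] [-> ->] //=.
(* Closing a lap trades a full [elapsed k] for one more [period]. *)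
by rewrite rk -/period /elapsed big_geq // addr0 intrD mulrDl mul1r.
Qed.

Let period_gt0 : 0 < period.
Proof.
rewrite /period /elapsed big_ltn // ltr_wpDr ?len_gt0 ?cycle_adj //.
rewrite big_seq; apply: sumr_ge0 => i; rewrite mem_index_iota => /andP[_ ik].
by rewrite ltW // len_gt0 // cycle_adj.
Qed.

(** Double counting of pairs of a leg and the edge it traverses: each edge is matched by exactly one
    leg, and each leg by at least one edge, of the same length. *)
Let period_le : period <= total_length G.
Proof.
pose z := zip c (rot 1 c).
pose same (p q : G * G) := (q == p) || (q == (p.2, p.1)).
have -> : total_length G = \sum_(q <- z) \sum_(p in edges G | same p q) len p.1 p.2.
  under [RHS]eq_bigr do rewrite big_mkcondr.
  rewrite exchange_big /=; apply: eq_bigr => p pE.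
  rewrite -big_mkcond /= big_const_seq iter_addr_0.
  by case: Ec => _ _ /(_ p pE) ->.
have -> : period = \sum_(q <- z) len q.1 q.2.
  rewrite (big_nth (x, x)) size_cycle_zip /period /elapsed !big_mkord.
  by apply: eq_bigr => i _; rewrite nth_cycle_zip.
rewrite big_seq [leRHS]big_seq; apply: ler_sum => q.
move=> /(nthP (x, x))[i]; rewrite size_cycle_zip => ik; rewrite nth_cycle_zip //.
move=> eq_q; have aq : adj q.1 q.2 by rewrite -eq_q cycle_adj.
have [p pE pq] : exists2 p, p \in edges G & same p q.
  have [qE|qE] := adj_edges aq.
    by exists q; rewrite ?/same ?eqxx //; case: (q) qE.
  by exists (q.2, q.1); rewrite // /same /= -surjective_pairing eqxx orbT.
rewrite (bigD1 p) ?pE //= ler_wpDr //.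
  by apply: sumr_ge0 => p' /andP[/andP[/edges_adj/len_gt0/ltW]].
by move: pq => /orP[] /eqP ->; rewrite //= len_sym // adj_sym edges_adj.
Qed.

Let cycle_leg p : p \in edges G -> exists2 i, (i < k)%N &
  (nth x c i, nth x c i.+1) = p \/ (nth x c i.+1, nth x c i) = p.
Proof.
move=> pE; case: Ec => _ _ /(_ p pE) cnt.
have /hasP[q] : has (fun q => (q == p) || (q == (p.2, p.1))) (zip c (rot 1 c)).
  by rewrite has_count cnt.
move=> /(nthP (x, x))[i]; rewrite size_cycle_zip => ik; rewrite nth_cycle_zip //.
move=> <- /orP[] /eqP e; exists i => //; first by left.
by right; case: e => -> ->; rewrite -surjective_pairing.
Qed.

Let cycle_shift (i : nat) (m : int) : (i < k)%N ->
  [/\ walk cycle_policy (m * k + i%:Z) = nth x c i,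
      walk cycle_policy (m * k + i%:Z + 1) = nth x c i.+1
    & depart cycle_policy (m * k + i%:Z) = m%:~R * period + elapsed i].
Proof.
move=> ik; have ek : ((m * k + i%:Z) %% k)%Z = i by rewrite modzMDl modz_small.
have k0 : k%:Z != 0 by rewrite eqz_nat -lt0n.
by rewrite walkS /= ek divzMDl // divz_small // addr0.
Qed.

Lemma cycle_feasible : feasible cycle_policy.
Proof.
split=> [n|n|p pE].
- by rewrite walkS cycle_adj.
- by rewrite cycle_departS walkS.
- have [i ik ip] := cycle_leg pE.
  by exists ((0 : int) * k + i%:Z); have [-> -> _] := cycle_shift 0 ik.
Qed.

(** The leg traversing [p] recurs once per lap at a fixed offset, so some visit falls in every
    window of length [period]. *)
Lemma cycle_recur p s t : p \in edges G -> 0 < s < len p.1 p.2 ->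
  exists r, t - period <= r <= t /\ visits cycle_policy p s r.
Proof.
move=> pE s0; have [i ik ip] := cycle_leg pE.
have shift y : exists m : int, t - period <= m%:~R * period + y <= t.
  (* The last lap whose visit at offset [y] occurs no later than [t]. *)
  exists (Num.floor ((t - y) / period)).
  have := floor_le ((t - y) / period); have := floorD1_gt ((t - y) / period).
  rewrite ltr_pdivrMr // ler_pdivlMr // intrD mulrDl mul1r => ? ?.
  by apply/andP; split; lra.
case: ip => ip.
  have [m hm] := shift (elapsed i + s).
  exists (m%:~R * period + elapsed i + s); rewrite -addrA; split => //.
  by exists (m * k + i%:Z); have [-> -> ->] := cycle_shift m ik; left; rewrite addrA.
have [m hm] := shift (elapsed i + (len p.1 p.2 - s)).
exists (m%:~R * period + elapsed i + (len p.1 p.2 - s)); rewrite -addrA; split => //.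
by exists (m * k + i%:Z); have [-> -> ->] := cycle_shift m ik; right; rewrite addrA.
Qed.

Lemma eulerian_optimal : exists psi : policy G,
  [/\ feasible psi, finite_age psi
    & is_AoI psi (2^-1 * total_length G ^+ 2)%:E].
Proof.
exists cycle_policy; split; first exact: cycle_feasible.
- exact: (recurrent_finite_age cycle_recur).
- exact: (recurrent_is_AoI cycle_feasible period_le cycle_recur).
Qed.

End eulerian.

(** As the limit may fail to exist, the lower limit of the time averages is bounded too; both bounds
    follow from the one for each finite horizon [T > 0]. *)
Theorem lemma1 (R : realType) (G : metric_graph R)
    (Gconn : graph_connected G) :
  (forall psi : policy G, feasible psi -> finite_age psi ->
     (forall L : \bar R, is_AoI psi L ->
        ((2^-1 * total_length G ^+ 2)%:E <= L)%E) /\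
     ((2^-1 * total_length G ^+ 2)%:E
        <= limf_einf (mean_age psi) +oo%R)%E) /\
  ((exists c : seq G, eulerian_cycle c) ->
     exists psi : policy G,
       [/\ feasible psi, finite_age psi
         & is_AoI psi (2^-1 * total_length G ^+ 2)%:E]).
Proof.
split=> [psi Fpsi _|[[|x c] Ec]]; last 2 first.
- by case: Ec.
- exact: (eulerian_optimal Ec (x := x)).
have lb : \forall T \near +oo%R,
    ((2^-1 * total_length G ^+ 2)%:E <= mean_age psi T)%E.
  near=> T; apply: mean_age_ge Fpsi _.
  by near: T; apply: nbhs_pinfty_gt; rewrite num_real.
split=> [L AoI|]; first exact: (@cvge_ge _ _ _ _ (mean_age psi) L _ lb AoI).
(* The lower limit is a supremum, over the neighbourhoods of [+oo], of infima; the set of [T] where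
   the bound holds is such a neighbourhood. *)
rewrite limf_einfE; apply: le_trans; last first.
  by apply: ereal_sup_ubound; eexists; [exact: lb|].
by apply: le_ereal_inf_tmp => _ [T cT <-].
Unshelve. all: by end_near. Qed.
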